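(* Let $n \ge 2$ and let $f$ be the $n$-dimensional border-collision normal form with matrices $A_L$, $A_R$. Suppose $\alpha > 1$ is an eigenvalue of $A_L$ with multiplicity one, $-\beta < -1$ is an eigenvalue of $A_R$ with multiplicity one, and all other eigenvalues of $A_L$ and $A_R$ have modulus at most $r$, where $0 < r < 1$. Let $\Omega$ be the polytope defined in the context. If $$r(n-1) < \frac{3}{7}\left(1 - \frac{1}{\alpha}\right) \quad\text{and}\quad r(n-1) < \frac{1}{10}\left(\frac{1}{\alpha} + \frac{1}{\beta} - 1\right),$$ then $\Omega$ is forward invariant under $f$, i.e. $f(\Omega) \subset \Omega$. Moreover, $\Omega$ can be perturbed into a trapping region.
   Context: Border-collision normal form: given an integer $n \ge 2$ and real parameters $a^L_1,\ldots,a^L_n,a^R_1,\ldots,a^R_n$, for each $Z \in \{L,R\}$ let $A_Z$ be the real $n \times n$ matrix whose first column is $(-a^Z_1,\ldots,-a^Z_n)^{\sf T}$, whose $(i,i+1)$ entries equal $1$ for $i = 1,\ldots,n-1$, and all of whose other entries are $0$. Let $b = (1,0,\ldots,0)^{\sf T}$, $f_L(x) = A_L x + b$, $f_R(x) = A_R x + b$, and $f(x) = f_L(x)$ if $x_1 \le 0$, $f(x) = f_R(x)$ if $x_1 \ge 0$. A trapping region for $f$ is a non-empty compact set $S$ with $f(S) \subset \mathrm{int}(S)$. That $\Omega$ can be perturbed into a trapping region means that there exists a trapping region $\Omega_\nu$ for $f$ that is a close approximation to $\Omega$. Construction of $\Omega$: $Y = (I - A_L)^{-1} b$ is the fixed point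 of $f_L$. $E = \{x \in \mathbb{R}^n : u^{\sf T}(x - Y) = 0\}$ with $u^{\sf T} = [\alpha^{n-1}, \alpha^{n-2}, \ldots, 1]$ is the hyperplane through $Y$ with directions given by the stable eigenvectors of $A_L$. $C = (C_1,0,\ldots,0)$ is the unique point on the $x_1$-axis with $f_R(C) \in E$. For $i = 2,\ldots,n$, $M_i = \frac{2\alpha}{\alpha-1}\binom{n-1}{i-1}$. $H = \{x \in \mathbb{R}^n : |x_i| \le M_i r^{i-1} \text{ for all } i = 2,\ldots,n\}$, $K = E \cap H$, and $\Omega$ is the convex hull of $\{C\} \cup K$. *)

(* Defs.v *)
From HB Require Import structures.
From mathcomp Require Import all_boot all_order all_algebra.
From mathcomp Require Export complex.
From mathcomp Require Import all_classical all_reals all_analysis.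

Set Implicit Arguments.
Unset Strict Implicit.
Unset Printing Implicit Defensive.

Import Order.TTheory GRing.Theory Num.Theory numFieldNormedType.Exports.
Local Open Scope classical_set_scope.
Local Open Scope ring_scope.

(* The phase space is R^(n+1), i.e. 'cV[R]_n.+1, with coordinates indexed from
   0: a quantity written with dimension N and indices i = 1..N in the
   literature appears here with n = N - 1 and i shifted down by one. *)

Section BorderCollision.
Variables (R : realType) (n : nat).
Implicit Types (a aL aR : 'I_n.+1 -> R) (x : 'cV[R]_n.+1).

Definition bcnf_mx a : 'M[R]_n.+1 :=
  \matrix_(i, j) (if j == ord0 then - a i else (j == i.+1 :> nat)%:R).

Definition bcnf_b : 'cV[R]_n.+1 := \col_i (i == ord0)%:R.

Definition bcnf_branch a x : 'cV[R]_n.+1 := bcnf_mx a *m x + bcnf_b.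

(* The two branches agree on x_0 = 0, since the two matrices differ only in
   their first column. *)
Definition bcnf aL aR x : 'cV[R]_n.+1 :=
  if x ord0 0 <= 0 then bcnf_branch aL x else bcnf_branch aR x.

(* [mu] is an eigenvalue of [A] of algebraic multiplicity one, and every other
   complex eigenvalue of [A] has modulus at most [r]. *)
Definition dominant_eigenvalue (A : 'M[R]_n.+1) (mu r : R) : Prop :=
  [/\ eigenvalue A mu,
      mup mu (char_poly A) = 1%N &
      forall z : R[i], eigenvalue (map_mx (real_complex R) A) z ->
        z != (mu%:C)%C -> `|z| <= (r%:C)%C].

Definition fixed_pt_L aL : 'cV[R]_n.+1 :=
  invmx (1%:M - bcnf_mx aL) *m bcnf_b.

Definition u_row (alpha : R) : 'rV[R]_n.+1 := \row_i alpha ^+ (n - i).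

Definition E_set aL (alpha : R) : set 'cV[R]_n.+1 :=
  [set x : 'cV[R]_n.+1 | u_row alpha *m (x - fixed_pt_L aL) = 0].

(* The point of the first coordinate axis that the right branch maps into E.
   It exists and is unique as soon as
   (u_row alpha *m bcnf_mx aR) 0 0 != 0. *)
Definition C_pt aL aR (alpha : R) : 'cV[R]_n.+1 :=
  xget 0 [set x : 'cV[R]_n.+1 | (forall i : 'I_n.+1, i != ord0 -> x i 0 = 0) /\
                  E_set aL alpha (bcnf_branch aR x)].

Definition M_coef (alpha : R) (i : nat) : R :=
  2 * alpha / (alpha - 1) * 'C(n, i)%:R.

Definition H_set (alpha r : R) : set 'cV[R]_n.+1 :=
  [set x : 'cV[R]_n.+1 | forall i : 'I_n.+1, i != ord0 ->
             `|x i 0| <= M_coef alpha i * r ^+ i].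

Definition K_set aL (alpha r : R) : set 'cV[R]_n.+1 :=
  E_set aL alpha `&` H_set alpha r.

Definition convex_hull (A : set 'cV[R]_n.+1) : set 'cV[R]_n.+1 :=
  smallest (@convex_set R 'cV[R]_n.+1) A.

Definition Omega aL aR (alpha r : R) : set 'cV[R]_n.+1 :=
  convex_hull ([set C_pt aL aR alpha] `|` K_set aL alpha r).

Definition trapping_region (f : 'cV[R]_n.+1 -> 'cV[R]_n.+1)
    (S : set 'cV[R]_n.+1) : Prop :=
  [/\ S !=set0, compact S & f @` S `<=` interior S].

(* [S] and [T] are within Hausdorff distance [eps] of each other. *)
Definition hausdorff_close (eps : R) (S T : set 'cV[R]_n.+1) : Prop :=
  (forall x, S x -> exists2 y, T y & `|x - y| <= eps) /\
  (forall y, T y -> exists2 x, S x & `|x - y| <= eps).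

Definition perturbable_to_trapping_region
    (f : 'cV[R]_n.+1 -> 'cV[R]_n.+1) (S : set 'cV[R]_n.+1) : Prop :=
  forall eps : R, 0 < eps ->
    exists S' : set 'cV[R]_n.+1,
      trapping_region f S' /\ hausdorff_close eps S' S.

End BorderCollision.

(* Main.v *)
Require Import Defs.
From mathcomp Require Import all_boot all_order all_algebra.
From mathcomp Require Import all_classical all_reals all_analysis.
From mathcomp Require Import perm zify lra ring.
Import Order.TTheory GRing.Theory Num.Theory numFieldNormedType.Exports.
Local Open Scope classical_set_scope.
Local Open Scope ring_scope.

Set Implicit Arguments.
Unset Strict Implicit.
Unset Printing Implicit Defensive.

(* Idea. Write a companion characteristic polynomial as (X - mu) q; all roots of
   q have modulus at most r, so the coefficients of q, hence the entries of A_L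
   and A_R, are bounded by binomial multiples of powers of r. Normalise the
   left eigenvector u^T of A_L into an affine function, the height, that vanishes
   on E: the left branch multiplies it by alpha. Omega is then a cone whose base
   K lies at height 0 and whose apex is C. As the map is affine on either side of
   x_0 = 0 and every segment from C to K crosses x_0 = 0 once, invariance needs
   only be checked on C, on K and at the crossing points, where it reduces to
   three strict scalar inequalities. Raising the base to a height nu > 0 and
   moving the apex so that its image has height 2 nu keeps these inequalities for
   small nu; heights then increase strictly on the base because alpha > 1, so the
   image falls into the interior of the new cone. *)

(** * Coefficients of a companion polynomial with a dominant root *)

(** Giving the matrix by its entries in an abstract dimension [m] confines the identification of [m]
    with [(size p).-1] to this proof. *)
Lemma char_poly_companion (R : comNzRingType) (p : {poly R}) m (A : 'M[R]_m) :
  p \is monic -> size p = m.+1 ->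
  (forall i j, A i j = if i == m.-1 :> nat then - p`_j else (i.+1 == j :> nat)%:R) ->
  char_poly A = p.
Proof.
move=> p_monic szp; have e : m = (size p).-1 by rewrite szp.
rewrite {szp}; move: A; rewrite e => A AE.
rewrite -[RHS]companionmxK //; congr char_poly.
by apply/matrixP => i j; rewrite AE mxE.
Qed.

Lemma det_permJ (R : comNzRingType) m (s : 'S_m) (A : 'M[R]_m) :
  \det (row_perm s (col_perm s A)) = \det A.
Proof.
rewrite row_permE col_permE !det_mulmx !det_perm odd_permV.
by rewrite mulrCA -signr_addb addbb mulr1.
Qed.

(** Reflection in the antidiagonal is transposition composed with conjugation by the order-reversing
    permutation. It moves the first column of [bcnf_mx] to the last row, which is the companion
    form. *)
Lemma char_poly_antitranspose (R : comNzRingType) m (A : 'M[R]_m) :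
  char_poly (\matrix_(i, j) A (rev_ord j) (rev_ord i)) = char_poly A.
Proof.
rewrite /char_poly -[RHS]det_tr -[RHS](det_permJ (perm (@rev_ord_inj m))).
congr (\det _); apply/matrixP => i j; rewrite !mxE !permE.
by rewrite (inj_eq rev_ord_inj) eq_sym.
Qed.

Lemma char_poly_bcnf (R : realType) n (a : 'I_n.+1 -> R) :
  char_poly (bcnf_mx a) =
  'X^(n.+1) + \poly_(j < n.+1) a (inord (n - j)).
Proof.
rewrite -char_poly_antitranspose.
have szq : (size (\poly_(j < n.+1) a (inord (n - j))) < size ('X^(n.+1) : {poly R}))%N.
  by rewrite size_polyXn ltnS size_poly.
apply: char_poly_companion.
- by rewrite monicE lead_coefDl // lead_coefXn.
- by rewrite size_polyDl // size_polyXn.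
move=> i j; rewrite !mxE /=.
have -> : (rev_ord i == ord0) = (i == n :> nat).
  by rewrite -val_eqE /= subSS subn_eq0 eqn_leq leq_ord.
case: ifP => [_|/negbT i_neq].
  rewrite coefD coefXn coef_poly ltn_ord ltn_eqF // add0r; congr (- a _).
  by apply/val_inj; rewrite /= inordK ?ltnS ?leq_subr // subSS.
have i_lt : (i < n)%N by rewrite ltn_neqAle i_neq -ltnS /=.
congr (_ %:R); rewrite !subSS; have := ltn_ord j; lia.
Qed.

(** The bound is the coefficient of [(X + r)^(size s)]: adding a factor [X - z] reproduces Pascal's
    rule. *)
Lemma coef_monic_bounded_roots (F : numFieldType) (s : seq F) (r : F) k :
  (forall z, z \in s -> `|z| <= r) ->
  `|(\prod_(z <- s) ('X - z%:P))`_k| <= 'C(size s, k)%:R * r ^+ (size s - k).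
Proof.
elim: s k => [|z s IHs] k zr.
  by rewrite big_nil coef1; case: k => [|k] /=; rewrite ?normr1 ?normr0 ?mulr1 ?mul0r.
have z_le : `|z| <= r by apply: zr; rewrite mem_head.
have r_ge0 : 0 <= r := le_trans (normr_ge0 z) z_le.
have {}IHs k' := IHs k' (fun y ys => zr y (mem_behead (s := z :: s) ys)).
have zIH k' : `|z * (\prod_(y <- s) ('X - y%:P))`_k'|
    <= 'C(size s, k')%:R * r ^+ ((size s).+1 - k').
  (* Above the degree the subtraction in the exponent may truncate, but there the binomial and the
     coefficient both vanish. *)
  have [k'_le|k'_gt] := leqP k' (size s); last first.
    by have := IHs k'; rewrite bin_small // !mul0r normr_le0 => /eqP->; rewrite mulr0 normr0.
  rewrite normrM subSn // exprS mulrCA.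
  by apply: ler_pM.
rewrite big_cons mulrBl coefB coefXM coefCM /=.
case: k => [|k] /=.
  by rewrite sub0r normrN (le_trans (zIH 0%N)) // !bin0.
rewrite (le_trans (ler_normB _ _)) // binS natrD mulrDl addrC subSS.
by apply: lerD => //; rewrite (le_trans (zIH _)) ?subSS.
Qed.

(** [b] lists, from the leading one down, the coefficients of the cofactor of [X - mu] in the
    characteristic polynomial; the last clause compares coefficients in the product. *)
Lemma dominant_eigenvalue_coef (R : realType) n (a : 'I_n.+1 -> R) (mu r : R) :
  dominant_eigenvalue (bcnf_mx a) mu r ->
  exists b : nat -> R, [/\ b 0%N = 1, forall i, `|b i| <= 'C(n, i)%:R * r ^+ i &
    forall i : 'I_n.+1, a i = b i.+1 - mu * b i].
Proof.
move=> [_ mup1 evr]; set p := char_poly _ in mup1.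
have p_monic : p \is monic by exact: char_poly_monic.
have p_neq0 := monic_neq0 p_monic.
have szp : size p = n.+2 by rewrite size_char_poly.
have /dvdpP[q pE] : 'X - mu%:P %| p by rewrite XsubC_dvd // mup1.
have q_monic : q \is monic by rewrite -(monicMr _ (monicXsubC mu)) -pE.
have q_neq0 := monic_neq0 q_monic.
have szq : size q = n.+1.
  by apply: succn_inj; rewrite -szp pE size_Mmonic ?monicXsubC // size_XsubC addn2.
(* Multiplicity one enters here: every complex root of [q] is then an eigenvalue other than [mu],
   hence of modulus at most [r]. *)
have qmu : ~~ root q mu.
  apply/negP => qmu; move: mup1; rewrite pE mupM ?polyXsubC_eq0 //.
  rewrite -[X in (_ + mup _ X)%N]expr1 mup_XsubCX eqxx.
  by move: qmu; rewrite -dvdp_XsubCl XsubC_dvd //; lia.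
pose toC := real_complex R; pose qC := map_poly toC q.
have [s qCE] := closed_field_poly_normal qC.
have qC_monic : qC \is monic by rewrite map_monic.
rewrite (monicP qC_monic) scale1r in qCE.
have szs : size s = n.
  by apply: succn_inj; rewrite -szq -(size_map_poly toC) -/qC qCE size_prod_XsubC.
have s_le z : z \in s -> `|z| <= (r%:C)%C.
  move=> zs; have qz : root qC z by rewrite qCE root_prod_XsubC.
  apply: evr.
    rewrite eigenvalue_root_char -map_char_poly -/p pE rmorphM /= rootM.
    by rewrite qz.
  apply: contraNneq qmu => z_mu; move: qz.
  by rewrite z_mu fmorph_root.
(* The cut-off matters at [i = n.+1], where the truncated [n - i] would return the constant
   coefficient instead of 0. *)
exists (fun i => if (i <= n)%N then q`_(n - i) else 0); split.
- by rewrite subn0; move/monicP: q_monic; rewrite lead_coefE szq.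
- move=> i; case: leqP => [i_le|i_gt]; last by rewrite normr0 bin_small // mul0r.
  have := coef_monic_bounded_roots (n - i) s_le.
  rewrite -qCE coef_map /= szs bin_sub // subKn //.
  rewrite normc_def /= expr0n addr0 sqrtr_sqr.
  by rewrite -(rmorph_nat toC) -rmorphXn -rmorphM lecR.
move=> i.
have i_le : (i <= n)%N by rewrite -ltnS.
have := congr1 (fun p : {poly R} => p`_(n - i)) pE.
rewrite /p char_poly_bcnf coefD coefXn coef_poly ltnS leq_subr ltn_eqF ?ltnS ?leq_subr //.
rewrite add0r subKn // inord_val => ->.
rewrite mulrBr coefB coefMX coefMC i_le mulrC; congr (_ - _).
rewrite subn_eq0 subnS. by case: ltnP.
Qed.

(** * Heights and cones *)

Section Cone.
Variables (R : realType) (n : nat) (alpha r : R).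
Hypotheses (alpha_gt1 : 1 < alpha) (r_gt0 : 0 < r).
Implicit Types (a : 'I_n.+1 -> R) (x y k : 'cV[R]_n.+1) (nu c : R).

Let alpha_gt0 : 0 < alpha. Proof. exact: lt_trans alpha_gt1. Qed.
Let alpha_neq0 : alpha != 0. Proof. exact: lt0r_neq0. Qed.

(** Extension by zero past the last coordinate lets the shift performed by [bcnf_mx] be written
    [entry x i.+1] in every row, the last included. *)
Definition entry x (j : nat) : R := if insub j is Some i then x i 0 else 0.

Lemma entry_ord x (i : 'I_n.+1) : entry x i = x i 0.
Proof. by rewrite /entry valK. Qed.

Lemma entry_out x : entry x n.+1 = 0.
Proof. by rewrite /entry insubF // ltnn. Qed.

Lemma bcnf_branchE a x (i : 'I_n.+1) :
  bcnf_branch a x i 0 = - a i * x ord0 0 + entry x i.+1 + (i == ord0)%:R.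
Proof.
rewrite !mxE big_ord_recl !mxE eqxx; congr (_ + _ + _).
have [i_lt|i_ge] := ltnP i n; last first.
  have -> : i = ord_max by apply/val_inj/eqP; rewrite eqn_leq i_ge leq_ord.
  rewrite entry_out big1 // => j _; rewrite mxE /= /bump add1n.
  by rewrite ltn_eqF ?mul0r // ltnS.
rewrite (bigD1 (Ordinal i_lt)) //= big1 => [|j j_neq]; last first.
  rewrite mxE /= /bump add1n eqSS; case: eqP => [jE|]; last by rewrite mul0r.
  by case/eqP: j_neq; apply/val_inj.
rewrite mxE /= /bump add1n eqxx mul1r addr0 -entry_ord.
by rewrite /= /bump add1n.
Qed.

(* Affine normalisation of [u_row]: it vanishes exactly on E. *)
Definition height x : R := \sum_(i < n.+1) alpha ^- i * x i 0 + (alpha - 1)^-1.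

Lemma height_comb (l : R) x y :
  height ((1 - l) *: x + l *: y) = (1 - l) * height x + l * height y.
Proof.
rewrite /height.
under eq_bigr do rewrite !mxE mulrDr mulrCA (mulrCA _ l).
by rewrite big_split /= -!mulr_sumr; ring.
Qed.

(** [slope a + alpha] is the characteristic polynomial of [bcnf_mx a] at [alpha], divided by
    [alpha ^+ n]; it vanishes exactly when [alpha] is an eigenvalue. *)
Definition slope a : R := \sum_(i < n.+1) alpha ^- i * a i.

(** The shift multiplies the weighted sum, less its first term, by [alpha]. The constant
    [(alpha - 1)^-1] in [height] is the one that absorbs the contribution 1 of [bcnf_b]. *)
Lemma height_branch a x :
  height (bcnf_branch a x) = alpha * height x - (slope a + alpha) * x ord0 0.
Proof.
rewrite /height /slope.
under eq_bigr do rewrite bcnf_branchE 2!mulrDr mulrA mulrN.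
rewrite 2!big_split /= -mulr_suml sumrN.
have -> : \sum_(i < n.+1) alpha ^- i * entry x i.+1 =
    alpha * (\sum_(i < n.+1) alpha ^- i * x i 0 - x ord0 0).
  under [in RHS]eq_bigr do rewrite -entry_ord.
  rewrite -entry_ord.
  have -> : \sum_(i < n.+1) alpha ^- i * entry x i =
      \sum_(i < n.+2) alpha ^- i * entry x i.
    by rewrite [RHS]big_ord_recr /= entry_out mulr0 addr0.
  rewrite [in RHS]big_ord_recl expr0 invr1 mul1r addrAC subrr add0r mulr_sumr.
  apply: eq_bigr => i _; rewrite /= /bump add1n mulrA exprS invfM mulrA.
  by rewrite divff // mul1r.
have -> : \sum_(i < n.+1) alpha ^- i * (i == ord0)%:R = 1.
  rewrite (bigD1 ord0) //= expr0 invr1 mul1r big1 ?addr0 // => i /negPf->.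
  by rewrite mulr0.
have : alpha - 1 != 0 by rewrite subr_eq0 gt_eqF.
by move=> ?; field.
Qed.

Lemma u_row_height x : (u_row n alpha *m x) 0 0 = alpha ^+ n * (height x - (alpha - 1)^-1).
Proof.
rewrite mxE addrK mulr_sumr; apply: eq_bigr => i _.
by rewrite mxE mulrA exprB ?unitfE // -ltnS.
Qed.

Definition apex c : 'cV[R]_n.+1 := \col_i (c *+ (i == ord0)).

Lemma height_apex c : height (apex c) = c + (alpha - 1)^-1.
Proof.
rewrite /height (bigD1 ord0) //= mxE eqxx expr0 invr1 mul1r big1 ?addr0 // => i /negPf i0.
by rewrite mxE i0 mulr0.
Qed.

Definition bnd (i : nat) : R := M_coef n alpha i * r ^+ i.

Lemma bndE i : bnd i = 2 * alpha / (alpha - 1) * ('C(n, i)%:R * r ^+ i).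
Proof. by rewrite /bnd /M_coef mulrA. Qed.

Lemma bnd_gt0 (i : 'I_n.+1) : 0 < bnd i.
Proof.
rewrite bndE !mulr_gt0 ?exprn_gt0 ?invr_gt0 ?subr_gt0 //.
by rewrite ltr0n bin_gt0 -ltnS.
Qed.

Lemma bnd_ge0 i : 0 <= bnd i.
Proof.
by rewrite bndE !mulr_ge0 ?ler0n ?exprn_ge0 ?invr_ge0 ?subr_ge0 // ltW.
Qed.

(** The translate of K along the first axis to height [nu]; K itself is the case [nu = 0]. *)
Definition base nu : set 'cV[R]_n.+1 :=
  [set k : 'cV[R]_n.+1 | height k = nu /\
    forall i : 'I_n.+1, i != ord0 -> `|k i 0| <= bnd i].

(* The convex hull of [apex c] and [base nu], given by inequalities. *)
Definition cone nu c : set 'cV[R]_n.+1 :=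
  [set x : 'cV[R]_n.+1 | nu <= height x /\ forall i : 'I_n.+1, i != ord0 ->
    `|x i 0| * (height (apex c) - nu) <= bnd i * (height (apex c) - height x)].

Lemma cone_join nu c l k : nu <= height (apex c) -> 0 <= l <= 1 -> base nu k ->
  cone nu c ((1 - l) *: apex c + l *: k).
Proof.
move=> nu_le /andP[l0 l1] [hk kb].
have hE := height_comb l (apex c) k; rewrite hk in hE; split.
  rewrite hE; have : 0 <= (1 - l) * (height (apex c) - nu) by rewrite mulr_ge0 ?subr_ge0.
  lra.
move=> i i0; rewrite hE !mxE (negPf i0) mulr0n mulr0 add0r.
have -> : bnd i * (height (apex c) - ((1 - l) * height (apex c) + l * nu)) =
  bnd i * l * (height (apex c) - nu) by ring.
rewrite ler_wpM2r ?subr_ge0 // normrM (ger0_norm l0) mulrC ler_wpM2r //.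
exact: kb.
Qed.

Lemma base_apex nu : base nu (apex (nu - (alpha - 1)^-1)).
Proof.
split; first by rewrite height_apex subrK.
by move=> i i0; rewrite mxE (negPf i0) normr0 bnd_ge0.
Qed.

Lemma cone_apex nu c : nu <= height (apex c) -> cone nu c (apex c).
Proof.
by split=> // i i0; rewrite mxE (negPf i0) normr0 mul0r subrr mulr0.
Qed.

Lemma base_cone nu c k : nu <= height (apex c) -> base nu k -> cone nu c k.
Proof.
move=> nu_le kbase; rewrite -[k]scale1r -[_ *: k]add0r -[0](scale0r (apex c)).
by rewrite -[in 0 *: _](subrr 1); apply: cone_join; rewrite ?ler01 ?lexx.
Qed.

(** Projection from the apex onto the base: [l] is the drop in height from the apex to [x], relative
    to the drop to the base. *)
Lemma cone_split nu c x : (0 < n)%N -> nu < height (apex c) -> cone nu c x ->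
  exists l k, [/\ 0 <= l <= 1, base nu k & x = (1 - l) *: apex c + l *: k].
Proof.
move=> n_gt0 nu_lt [nu_le xb]; set G := height (apex c) in nu_lt xb *.
have Gnu : 0 < G - nu by rewrite subr_gt0.
pose l := (G - height x) / (G - nu).
have lE : l * (G - nu) = G - height x by rewrite divfK // gt_eqF.
have l1 : l <= 1 by rewrite ler_pdivrMr // mul1r lerD2l lerN2.
have one_neq0 : (inord 1 : 'I_n.+1) != ord0 by rewrite -val_eqE /= inordK.
(* The lateral inequality at any coordinate but the first keeps [x] below the apex; [0 < n] provides
   such a coordinate. *)
have l0 : 0 <= l.
  rewrite divr_ge0 ?(ltW Gnu) // -(pmulr_rge0 _ (bnd_gt0 (inord 1))).
  by rewrite (le_trans _ (xb _ one_neq0)) // mulr_ge0 // ltW.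
have xl i : i != ord0 -> `|x i 0| <= l * bnd i.
  move=> i0; rewrite -(ler_pM2r Gnu) [leRHS]mulrAC lE [leRHS]mulrC.
  exact: xb.
(* For [l = 0] the projection is undefined; [x] is then the apex and any base point serves. *)
move: l0; rewrite le_eqVlt => /predU1P[l0|l0].
  have xi i : i != ord0 -> x i 0 = 0.
    by move=> /xl; rewrite -l0 mul0r normr_le0 => /eqP.
  have hx : height x = G by apply/eqP; rewrite eq_sym -subr_eq0 -lE -l0 mul0r.
  exists 0, (apex (nu - (alpha - 1)^-1)); split; [by rewrite lexx ler01 | exact: base_apex |].
  rewrite subr0 scale1r scale0r addr0; apply/colP => i; rewrite mxE.
  have [->|i0] := eqVneq i ord0; last by rewrite xi.
  move: hx; rewrite /G height_apex /height (bigD1 ord0) //= big1 => [|j /xi->]; last first.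
    by rewrite mulr0.
  by rewrite expr0 invr1 mul1r addr0 => /addIr.
have l_neq0 : l != 0 by rewrite gt_eqF.
exists l, ((1 - l^-1) *: apex c + l^-1 *: x); split.
- by rewrite l1 ltW.
- split.
    rewrite height_comb -/G; apply: (mulfI l_neq0); rewrite mulrDr !mulrA.
    rewrite mulrBr divff // mul1r mulr1; lra.
  move=> i i0; rewrite !mxE (negPf i0) mulr0n mulr0 add0r normrM.
  by rewrite gtr0_norm ?invr_gt0 // ler_pdivrMl // xl.
rewrite scalerDr !scalerA mulrBr divff // mulr1 scale1r addrA -scalerDl.
by rewrite (_ : 1 - l + (l - 1) = 0) ?scale0r ?add0r //; ring.
Qed.

Lemma norm_comb (l : R) x y (i : 'I_n.+1) : 0 <= l <= 1 ->
  `|((1 - l) *: x + l *: y) i 0| <= (1 - l) * `|x i 0| + l * `|y i 0|.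
Proof.
move=> /andP[l0 l1]; rewrite !mxE (le_trans (ler_normD _ _)) // !normrM.
by rewrite (ger0_norm l0) ger0_norm // subr_ge0.
Qed.

Lemma cone_comb nu c (l : R) x y : nu <= height (apex c) -> 0 <= l <= 1 ->
  cone nu c x -> cone nu c y -> cone nu c ((1 - l) *: x + l *: y).
Proof.
move=> nu_le l01 [hx xb] [hy yb]; have /andP[l0 l1] := l01.
split; first by rewrite height_comb; nra.
move=> i i0; rewrite height_comb.
have Gnu : 0 <= height (apex c) - nu by rewrite subr_ge0.
rewrite (le_trans (ler_wpM2r Gnu (norm_comb _ _ _ l01))) //.
have := xb i i0; have := yb i i0; nra.
Qed.

(** The lateral inequalities are those of [cone nu c] made strict, while the lower height [nu']
    stays free: [nu' = nu = 0] serves invariance, [nu' > nu] serves trapping. *)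
Definition target nu nu' c : set 'cV[R]_n.+1 :=
  [set x : 'cV[R]_n.+1 | nu' <= height x /\ forall i : 'I_n.+1, i != ord0 ->
    `|x i 0| * (height (apex c) - nu) < bnd i * (height (apex c) - height x)].

Lemma target_comb nu nu' c (l : R) x y : nu <= height (apex c) -> 0 <= l <= 1 ->
  target nu nu' c x -> target nu nu' c y ->
  target nu nu' c ((1 - l) *: x + l *: y).
Proof.
move=> nu_le l01 [hx xb] [hy yb]; have /andP[l0 l1] := l01.
split; first by rewrite height_comb; nra.
move=> i i0; rewrite height_comb.
have Gnu : 0 <= height (apex c) - nu by rewrite subr_ge0.
rewrite (le_lt_trans (ler_wpM2r Gnu (norm_comb _ _ _ l01))) //.
have := xb i i0; have := yb i i0; move: l0; rewrite le_eqVlt => /predU1P[<-|l0].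
  lra.
nra.
Qed.

Lemma Omega_cone aL aR c : (0 < n)%N -> 0 < height (apex c) ->
  C_pt aL aR alpha = apex c -> K_set aL alpha r = base 0 ->
  Omega aL aR alpha r = cone 0 c.
Proof.
move=> n_gt0 G_gt0 CE KE; rewrite /Omega CE KE; apply/seteqP; split.
  apply: smallest_sub.
    move=> x y t /set_mem xb /set_mem yb; apply/mem_set.
    have -> : conv t x y = (1 - t%:num) *: (y : 'cV[R]_n.+1) + t%:num *: (x : 'cV[R]_n.+1).
      by rewrite addrC.
    by apply: cone_comb => //; [exact: ltW | rewrite ge0 le1].
  by move=> x [->|]; [exact/cone_apex/ltW | exact/base_cone/ltW].
move=> x /(cone_split n_gt0 G_gt0)[l [k [/andP[l0 l1] kb ->]]] B [Bconv CKB].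
rewrite addrC; apply/set_mem; apply: (Bconv k (apex c) (Itv01 l0 l1)).
  by apply/mem_set/CKB; right.
by apply/mem_set/CKB; left.
Qed.

End Cone.

(** * Images of cones *)

(** Follows from [(i + 1) C(n, i + 1) = (n - i) C(n, i)] and [i + 1 >= 2]. The half gained is the
    one in the [t / 2] of the later estimates. *)
Lemma bin_succ_half n i : (0 < i)%N -> (2 * 'C(n, i.+1) <= n * 'C(n, i))%N.
Proof.
move=> i_gt0; apply: (@leq_trans (i.+1 * 'C(n, i.+1))); first by rewrite leq_mul2r ltnS i_gt0 orbT.
by rewrite mul_bin_left leq_mul2r leq_subr orbT.
Qed.

(** A Bernoulli-type induction gives [(1 + y)^n (1 - n y) <= 1], and [1 - n y >= 9/10]. *)
Lemma expr1D_sub1_le (R : realFieldType) (y : R) n : 0 <= y -> n%:R * y <= 1 / 10 ->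
  (1 + y) ^+ n - 1 <= 10 / 9 * (n%:R * y).
Proof.
move=> y0 ny.
have : (1 + y) ^+ n * (1 - n%:R * y) <= 1.
  elim: n {ny} => [|n IHn]; first by rewrite expr0 mul0r subr0 mulr1.
  apply: le_trans IHn; rewrite exprSr -mulrA ler_wpM2l ?exprn_ge0 ?addr_ge0 //.
  rewrite -natr1; have := mulr_ge0 (ler0n R n) (sqr_ge0 y); have := sqr_ge0 y; lra.
have : 1 <= (1 + y) ^+ n by rewrite exprn_ege1 // lerDl.
nra.
Qed.

Section Estimates.
Variables (R : realType) (n : nat) (alpha r : R).
Hypotheses (alpha_gt1 : 1 < alpha) (r_gt0 : 0 < r).
Implicit Types (a : 'I_n.+1 -> R) (x y k : 'cV[R]_n.+1) (nu c : R).

Let alpha_gt0 : 0 < alpha. Proof. exact: lt_trans alpha_gt1. Qed.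
Let alpha_neq0 : alpha != 0. Proof. exact: lt0r_neq0. Qed.
Let alpha1_gt0 : 0 < alpha - 1. Proof. by rewrite subr_gt0. Qed.

Local Notation t := (r * n%:R).
(** By the binomial theorem, the sum over [i >= 1] of [C(n, i) (r / alpha)^i], that is, of the
    coefficient bounds weighted as in [height]. *)
Definition delta := (1 + r / alpha) ^+ n - 1.

Let t_ge0 : 0 <= t. Proof. by rewrite mulr_ge0 // ltW. Qed.

Lemma weighted_sum_le (v : 'I_n.+1 -> R) m :
  (forall i, i != ord0 -> `|v i| <= m * ('C(n, i)%:R * r ^+ i)) ->
  `|\sum_(i < n.+1 | i != ord0) alpha ^- i * v i| <= m * delta.
Proof.
move=> vb.
have -> : delta = \sum_(i < n.+1 | i != ord0) alpha ^- i * ('C(n, i)%:R * r ^+ i).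
  rewrite /delta exprDn (bigD1 ord0) //= expr1n bin0 expr0 mulr1n mulr1 addrAC subrr add0r.
  apply: eq_bigr => i _; rewrite expr1n mul1r exprMn exprVn -mulr_natl.
  by rewrite mulrA mulrC.
rewrite mulr_sumr (le_trans (ler_norm_sum _ _ _)) //; apply: ler_sum => i i0.
rewrite normrM gtr0_norm ?invr_gt0 ?exprn_gt0 // mulrCA ler_wpM2l ?vb //.
by rewrite invr_ge0 exprn_ge0 // ltW.
Qed.

Lemma bin_succ_le (i : 'I_n.+1) : i != ord0 ->
  'C(n, i.+1)%:R * r ^+ i.+1 <= t / 2 * ('C(n, i)%:R * r ^+ i).
Proof.
rewrite -val_eqE -lt0n => /(@bin_succ_half n).
rewrite -(ler_nat R) !natrM => binb.
rewrite exprS mulrCA !mulrA ler_wpM2r ?exprn_ge0 ?(ltW r_gt0) //.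
have : 0 <= r * (n%:R * 'C(n, i)%:R - 2 * 'C(n, i.+1)%:R) by rewrite mulr_ge0 ?subr_ge0 // ltW.
lra.
Qed.

Lemma coef_le a (b : nat -> R) mu : (forall i, `|b i| <= 'C(n, i)%:R * r ^+ i) ->
  (forall i : 'I_n.+1, a i = b i.+1 - mu * b i) ->
  forall i, i != ord0 -> `|a i| <= (t / 2 + `|mu|) * ('C(n, i)%:R * r ^+ i).
Proof.
move=> bb aE i i0; rewrite aE (le_trans (ler_normB _ _)) // mulrDl normrM.
by rewrite lerD ?ler_wpM2l // (le_trans (bb _)) // bin_succ_le.
Qed.

(** For the cofactor coefficients, [B] is the cofactor at [alpha] over [alpha ^+ n]. At [mu = alpha]
    it cancels and the slope is exactly [- alpha]; at [mu = - beta] the slope is close to [beta]. *)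
Lemma slopeE a (b : nat -> R) mu : b 0%N = 1 ->
  (forall i, `|b i| <= 'C(n, i)%:R * r ^+ i) ->
  (forall i : 'I_n.+1, a i = b i.+1 - mu * b i) ->
  exists2 B, slope alpha a = alpha * (B - 1) - mu * B & `|B - 1| <= delta.
Proof.
move=> b0 bb aE; exists (\sum_(i < n.+1) alpha ^- i * b i).
  have bn : b n.+1 = 0.
    by apply/eqP; rewrite -normr_le0 (le_trans (bb _)) // bin_small // mul0r.
  rewrite /slope.
  under eq_bigr do rewrite aE mulrBr mulrCA.
  rewrite sumrB -mulr_sumr; congr (_ - _).
  have -> : \sum_(i < n.+1) alpha ^- i * b i = \sum_(i < n.+2) alpha ^- i * b i.
    by rewrite [RHS]big_ord_recr /= bn mulr0 addr0.
  rewrite [in RHS]big_ord_recl expr0 invr1 mul1r b0 addrAC subrr add0r mulr_sumr.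
  apply: eq_bigr => i _; rewrite /= /bump add1n mulrA exprS invfM mulrA.
  by rewrite divff // mul1r.
rewrite (bigD1 ord0) //= expr0 invr1 mul1r b0 addrAC subrr add0r -[delta]mul1r.
by apply: weighted_sum_le => i _; rewrite mul1r.
Qed.

Lemma bnd_succ_le (i : 'I_n.+1) : i != ord0 -> bnd n alpha r i.+1 <= t / 2 * bnd n alpha r i.
Proof.
move=> i0; rewrite !bndE [leRHS]mulrCA ler_wpM2l ?bin_succ_le //.
by rewrite divr_ge0 ?mulr_ge0 ?(ltW alpha1_gt0) // ltW.
Qed.

(** How far the first coordinate of a base point can lie from the point where the base meets the
    first axis. *)
Definition width := 2 * alpha / (alpha - 1) * delta.

Lemma width_ge0 : 0 <= width.
Proof.
rewrite mulr_ge0 ?divr_ge0 ?mulr_ge0 ?(ltW alpha1_gt0) ?(ltW alpha_gt0) //.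
by rewrite subr_ge0 exprn_ege1 // lerDl divr_ge0 ?(ltW r_gt0) // ltW.
Qed.

Lemma base_coord0 nu k : base alpha r nu k ->
  `|k ord0 0 - (nu - (alpha - 1)^-1)| <= width.
Proof.
move=> [hk kb].
have -> : k ord0 0 - (nu - (alpha - 1)^-1) =
    - \sum_(i < n.+1 | i != ord0) alpha ^- i * k i 0.
  by rewrite -hk /height (bigD1 ord0) //= expr0 invr1 mul1r; ring.
by rewrite normrN weighted_sum_le // => i /kb; rewrite bndE.
Qed.

Lemma entry_base_succ nu k (i : 'I_n.+1) : base alpha r nu k -> i != ord0 ->
  `|entry k i.+1| <= t / 2 * bnd n alpha r i.
Proof.
move=> [_ kb] i0; have [i_lt|i_ge] := ltnP i n.
  have -> : i.+1 = Ordinal (i_lt : (i.+1 < n.+1)%N) by [].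
  rewrite entry_ord (le_trans (kb _ _)) //; exact: bnd_succ_le.
have -> : i.+1 = n.+1 by congr _.+1; apply/eqP; rewrite eqn_leq i_ge leq_ord.
by rewrite entry_out normr0 mulr_ge0 ?divr_ge0 ?bnd_ge0.
Qed.

Section Trapping.
Variables (aL aR : 'I_n.+1 -> R) (beta nu : R).
Local Notation f := (bcnf aL aR).
Let sigma := slope alpha aR.
(* The apex at [c] is mapped by the right branch to height [2 * nu]. *)
Let c := (alpha / (alpha - 1) - 2 * nu) / sigma.
Let G := c + (alpha - 1)^-1.
Let kb := (alpha - 1)^-1 + width.

Hypotheses (aL_le : forall i, i != ord0 -> `|aL i| <= (t / 2 + alpha) * ('C(n, i)%:R * r ^+ i))
  (aR_le : forall i, i != ord0 -> `|aR i| <= (t / 2 + beta) * ('C(n, i)%:R * r ^+ i))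
  (aL_slope : slope alpha aL = - alpha).
(** [c_gt0] and [nu_lt] put apex and base strictly on opposite sides of [x_0 = 0], and [kb] bounds
    [|x_0|] on the base. The three [cond_] inequalities are the lateral inequalities for the images
    of the base, the apex and the crossing points. *)
Hypotheses (n_gt0 : (0 < n)%N) (nu_ge0 : 0 <= nu) (sigma_neq0 : sigma != 0) (c_gt0 : 0 < c)
  (nu_lt : nu + width < (alpha - 1)^-1)
  (cond_base : (alpha + t / 2) * kb * (G - nu) + alpha * t / (alpha - 1) * (G - nu) <
     2 * alpha / (alpha - 1) * (G - alpha * nu))
  (cond_apex : (beta + t / 2) * c * (G - nu) < 2 * alpha / (alpha - 1) * (G - 2 * nu))
  (cond_mid : t / 2 * (G - nu) * (c + kb) + alpha * (G - nu) * kb <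
     (G - alpha * nu) * (c + kb)).

Let GE : height alpha (apex n c) = G. Proof. exact: height_apex. Qed.
Let nuG : 0 < G - nu.
Proof. by rewrite /G; have := c_gt0; have := nu_lt; have := width_ge0; lra. Qed.
Let kb_ge0 : 0 <= kb. Proof. by rewrite addr_ge0 ?width_ge0 // invr_ge0 ltW. Qed.
Let binr_gt0 (i : 'I_n.+1) : 0 < 'C(n, i)%:R * r ^+ i.
Proof. by rewrite mulr_gt0 ?exprn_gt0 // ltr0n bin_gt0 -ltnS. Qed.

(** Images of base points have height [alpha * nu] and the image of the apex has height [2 * nu],
    hence the minimum. *)
Local Notation target := (target alpha r nu (Num.min 2 alpha * nu) c).

Lemma base_coord0_itv k : base alpha r nu k -> - kb <= k ord0 0 < 0.
Proof.
by move=> /base_coord0; rewrite ler_norml /kb => /andP[]; move: nu_lt nu_ge0; lra.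
Qed.

Lemma branch_base_target k : base alpha r nu k -> target (bcnf_branch aL k).
Proof.
move=> kbase; have [hk _] := kbase.
have /andP[k0_ge k0_lt] := base_coord0_itv kbase.
have hE : height alpha (bcnf_branch aL k) = alpha * nu.
  by rewrite height_branch // aL_slope addNr mul0r subr0 hk.
split; first by rewrite hE ler_wpM2r // ge_min lexx orbT.
move=> i i0; rewrite hE GE bcnf_branchE (negPf i0) addr0 bndE.
have ci := entry_base_succ kbase i0; rewrite bndE in ci.
have := binr_gt0 i; set p := _ * r ^+ i in ci *; move=> p_gt0.
have ai : `|- aL i * k ord0 0| <= (t / 2 + alpha) * p * kb.
  rewrite normrM normrN ler_pM ?aL_le // ler_norml k0_ge /=.
  by rewrite (le_trans (ltW k0_lt)).
rewrite (le_lt_trans (ler_wpM2r (ltW nuG) (le_trans (ler_normD _ _) (lerD ai ci)))) //.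
have : 0 < p * (2 * alpha / (alpha - 1) * (G - alpha * nu) -
   ((alpha + t / 2) * kb * (G - nu) + alpha * t / (alpha - 1) * (G - nu))).
  by rewrite mulr_gt0 // subr_gt0.
lra.
Qed.

Lemma branch_apex_target : target (bcnf_branch aR (apex n c)).
Proof.
have c0 : apex n c ord0 0 = c by rewrite mxE eqxx.
have alpha1_neq0 : alpha - 1 != 0 by rewrite gt_eqF.
have hE : height alpha (bcnf_branch aR (apex n c)) = 2 * nu.
  rewrite height_branch // GE c0 -/sigma /G /c; field.
  by rewrite sigma_neq0.
split; first by rewrite hE ler_wpM2r // ge_min lexx.
move=> i i0; rewrite hE GE bcnf_branchE (negPf i0) addr0 bndE c0.
have -> : entry (apex n c) i.+1 = 0.
  by rewrite /entry; case: insubP => // j _ jE; rewrite mxE -val_eqE /= jE.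
rewrite addr0 normrM normrN (gtr0_norm c_gt0).
have := binr_gt0 i; have := aR_le i0; set p := _ * r ^+ i => ai p_gt0.
have : 0 < p * (2 * alpha / (alpha - 1) * (G - 2 * nu) - (beta + t / 2) * c * (G - nu)).
  by rewrite mulr_gt0 // subr_gt0.
have : `|aR i| * (c * (G - nu)) <= (t / 2 + beta) * p * (c * (G - nu)).
  by rewrite ler_wpM2r // mulr_ge0 // ltW.
lra.
Qed.

(** At [x_0 = 0] the matrix acts on the coordinates as a pure shift, so their bounds shrink by
    [t / 2]; the cost is the height, multiplied by [alpha]. *)
Lemma branch_mid_target k m : base alpha r nu k -> 0 <= m <= 1 ->
  ((1 - m) *: apex n c + m *: k) ord0 0 = 0 ->
  target (bcnf_branch aL ((1 - m) *: apex n c + m *: k)).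
Proof.
move=> kbase /andP[m0 m1] z0; have [hk _] := kbase.
have /andP[k0_ge k0_lt] := base_coord0_itv kbase.
have hE : height alpha (bcnf_branch aL ((1 - m) *: apex n c + m *: k)) =
    alpha * (G - m * (G - nu)).
  by rewrite height_branch // aL_slope addNr mul0r subr0 height_comb hk GE; ring.
split.
  rewrite hE; apply: (@le_trans _ _ (alpha * nu)).
    by rewrite ler_wpM2r // ge_min lexx orbT.
  by rewrite ler_wpM2l ?(ltW alpha_gt0) //; move: nuG m1; nra.
move=> i i0; rewrite hE GE bcnf_branchE (negPf i0) addr0 z0 mulr0 add0r.
have -> : entry ((1 - m) *: apex n c + m *: k) i.+1 = m * entry k i.+1.
  rewrite /entry; case: insubP => [j _ jE|_]; last by rewrite mulr0.
  by rewrite !mxE -val_eqE /= jE mulr0 add0r.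
rewrite normrM (ger0_norm m0) [ltRHS]mulrC.
have ci := entry_base_succ kbase i0; have := bnd_gt0 alpha_gt1 r_gt0 i.
set h := bnd _ _ _ _ in ci * => h_gt0.
have mci : m * `|entry k i.+1| <= t / 2 * h.
  by rewrite (le_trans _ ci) // ler_piMl.
rewrite (le_lt_trans (ler_wpM2r (ltW nuG) mci)) // mulrAC ltr_pM2r //.
(* The crossing condition reads [(1 - m) c = - m k_0], at most [m kb]; this limits the weight of the
   apex and so the height of the crossing point. *)
have m_le : (1 - m) * (c + kb) <= kb.
  have {}z0 : (1 - m) * c + m * k ord0 0 = 0 by move: z0; rewrite !mxE eqxx.
  have : m * - kb <= m * k ord0 0 by rewrite ler_wpM2l.
  lra.
have ckb : 0 < c + kb by rewrite ltr_pwDl.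
rewrite -(ltr_pM2r ckb).
have : alpha * (G - nu) * ((1 - m) * (c + kb)) <= alpha * (G - nu) * kb.
  by rewrite ler_wpM2l // mulr_ge0 // ltW.
move: cond_mid; lra.
Qed.

Lemma branch_comb a l x y :
  bcnf_branch a ((1 - l) *: x + l *: y) =
  (1 - l) *: bcnf_branch a x + l *: bcnf_branch a y.
Proof.
rewrite /bcnf_branch mulmxDr -!scalemxAr !scalerDr addrACA -scalerDl.
by rewrite subrK scale1r.
Qed.

Lemma branch_eq x : x ord0 0 = 0 -> bcnf_branch aL x = bcnf_branch aR x.
Proof. by move=> x0; apply/colP => i; rewrite !bcnf_branchE x0 !mulr0. Qed.

Lemma bcnf_cone_target x : cone alpha r nu c x -> target (f x).
Proof.
have nu_ltG : nu < height alpha (apex n c) by rewrite GE -subr_gt0.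
move=> /(cone_split alpha_gt1 r_gt0 n_gt0 nu_ltG)[l [k [/andP[l0 l1] kbase xE]]].
have /andP[_ k0_lt] := base_coord0_itv kbase; set k0 := k ord0 0 in k0_lt.
have ck0 : 0 < c - k0 by rewrite subr_gt0 (lt_trans k0_lt).
(* Parameter at which the segment from the apex to [k] meets [x_0 = 0]. *)
pose m := c / (c - k0).
have m_gt0 : 0 < m by rewrite divr_gt0.
have m_lt1 : m < 1 by rewrite ltr_pdivrMr // mul1r ltrDl oppr_gt0.
have m01 : 0 <= m <= 1 by rewrite !ltW.
have mE : m * (c - k0) = c by rewrite divfK // gt_eqF.
set z := (1 - m) *: apex n c + m *: k.
have z0 : z ord0 0 = 0 by rewrite !mxE eqxx mulr1n -/k0; move: mE; lra.
have zT : target (bcnf_branch aL z) by exact: branch_mid_target.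
have x0E : x ord0 0 = (m - l) * (c - k0).
  by rewrite xE !mxE eqxx mulr1n -/k0; move: mE; lra.
have m_neq0 : m != 0 by rewrite gt_eqF.
have m1_neq0 : 1 - m != 0 by rewrite subr_eq0 gt_eqF.
(* For [m <= l] the point lies between [z] and [k], otherwise between the apex and [z]; each piece
   uses one affine branch, and both branches agree at [z]. *)
rewrite /bcnf x0E pmulr_lle0 // subr_le0; case: ifP => [ml|/negbT]; last rewrite -ltNge => lm.
  have -> : x = (1 - (l - m) / (1 - m)) *: z + ((l - m) / (1 - m)) *: k.
    by rewrite xE /z; apply/colP => i; rewrite !mxE; field.
  rewrite branch_comb; apply: target_comb => //; [exact: ltW | | exact: branch_base_target].
  by rewrite divr_ge0 ?subr_ge0 ?(ltW m_lt1) //= ler_pdivrMr ?subr_gt0 // mul1r lerB.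
have -> : x = (1 - l / m) *: apex n c + (l / m) *: z.
  by rewrite xE /z; apply/colP => i; rewrite !mxE; field.
rewrite branch_comb -(branch_eq z0);
  apply: target_comb => //; [exact: ltW | | exact: branch_apex_target].
by rewrite divr_ge0 ?(ltW m_gt0) //= ler_pdivrMr // mul1r ltW.
Qed.

End Trapping.
End Estimates.

(** * The scalar inequalities *)

Section Numeric.
Variables (R : realFieldType) (alpha beta t d sigma : R).
Hypotheses (alpha_gt1 : 1 < alpha) (beta_gt1 : 1 < beta) (t_ge0 : 0 <= t)
  (t_lt : t < 1 / 10 * (1 / alpha + 1 / beta - 1))
  (d_ge0 : 0 <= d) (d_le : d <= 10 / 9 * (t / alpha))
  (sigma_near : `|sigma - beta| <= (alpha + beta) * d).
Let w := 2 * alpha / (alpha - 1) * d.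
Let c := alpha / (alpha - 1) / sigma.
Let kb := (alpha - 1)^-1 + w.

Let alpha_gt0 : 0 < alpha. Proof. exact: lt_trans alpha_gt1. Qed.
Let beta_gt0 : 0 < beta. Proof. exact: lt_trans beta_gt1. Qed.
Let p_gt0 : 0 < (alpha - 1)^-1. Proof. by rewrite invr_gt0 subr_gt0. Qed.
Let pE : (alpha - 1)^-1 * (alpha - 1) = 1.
Proof. by rewrite mulVf // subr_eq0 gt_eqF. Qed.
(** In these variables the hypotheses lose their quotients: [10 t < a + b - 1] and [e <= 10/9 t], a
    form suited to linear arithmetic. *)
Let a := alpha^-1.
Let b := beta^-1.
Let e := alpha * d.
Let a_itv : 0 < a < 1. Proof. by rewrite invr_gt0 invf_lt1 ?alpha_gt0. Qed.
Let b_itv : 0 < b < 1. Proof. by rewrite invr_gt0 invf_lt1 ?beta_gt0. Qed.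
Let aE : a * alpha = 1. Proof. by rewrite mulVf // gt_eqF. Qed.
Let bE : b * beta = 1. Proof. by rewrite mulVf // gt_eqF. Qed.
Let t_ab : 10 * t < a + b - 1. Proof. by move: t_lt; rewrite !div1r -/a -/b; lra. Qed.
Let e_ge0 : 0 <= e. Proof. by rewrite mulr_ge0 // ltW. Qed.
Let e_le : e <= 10 / 9 * t.
Proof.
have : alpha * d <= alpha * (10 / 9 * (t / alpha)) by rewrite ler_wpM2l // ltW.
by rewrite (mulrCA alpha) [alpha * (t / _)]mulrC divfK ?gt_eqF.
Qed.
Let t_small : t < 1 / 10. Proof. by move: t_ab a_itv b_itv; lra. Qed.
Let e_small : e <= 1 / 9. Proof. by move: e_le t_small; lra. Qed.
Let dE : d = e * a. Proof. by rewrite mulrC mulrA aE mul1r. Qed.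

(** Although [beta] is unbounded, multiplying [10 t < a + b - 1] by [beta] and using [a < 1] gives
    [10 beta t < 1]. *)
Let betad_le : beta * d <= 1 / 9.
Proof.
have bt : beta * (10 * t) < beta * (a + b - 1) by rewrite ltr_pM2l.
have ba : beta * a < beta by rewrite gtr_pMr //; case/andP: a_itv.
have : beta * d <= beta * (10 / 9 * t).
  rewrite ler_wpM2l ?(ltW beta_gt0) // (le_trans _ e_le) // dE ler_piMr //.
  by rewrite ltW //; case/andP: a_itv.
move: bt ba bE; lra.
Qed.

Let sigma_itv : beta - 2 / 9 <= sigma <= beta + e + beta * d.
Proof.
move: sigma_near; rewrite ler_norml mulrDl -/e => /andP[? ?].
by move: betad_le e_small; lra.
Qed.

Lemma sigma_gt0 : 0 < sigma.
Proof. by move: sigma_itv beta_gt1; lra. Qed.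

Let wE : w = 2 * e * (alpha - 1)^-1. Proof. by rewrite /w /e; ring. Qed.

Lemma width_lt : w < (alpha - 1)^-1.
Proof. by rewrite wE gtr_pMl //; move: e_small; lra. Qed.

(** Multiplied by [alpha - 1], the left side is [alpha] up to errors controlled by [t]; the factor 2
    in [M_coef] leaves the room. *)
Lemma base_bound : (alpha + t / 2) * kb + alpha * t / (alpha - 1) < 2 * alpha / (alpha - 1).
Proof.
have : (alpha + t / 2) * (1 + 2 * e) + alpha * t < 2 * alpha.
  have : alpha * e <= alpha * (1 / 9) by rewrite ler_wpM2l // ltW.
  have : alpha * t <= alpha * (1 / 10) by rewrite ler_wpM2l // ltW.
  have : t * e <= 1 / 10 * (1 / 9) by rewrite ler_pM // ltW.
  move: alpha_gt1 t_small; lra.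
rewrite -(ltr_pM2l p_gt0) /kb wE; lra.
Qed.

(** Cancelling [alpha / (alpha - 1)] leaves [beta + t / 2 < 2 * sigma], with [sigma] close to
    [beta]. *)
Lemma apex_bound : (beta + t / 2) * c < 2 * alpha / (alpha - 1).
Proof.
rewrite mulrA ltr_pdivrMr ?sigma_gt0 //.
have : 0 < alpha / (alpha - 1) * (2 * sigma - (beta + t / 2)).
  rewrite !mulr_gt0 // subr_gt0; move: sigma_itv beta_gt1 t_small; lra.
lra.
Qed.

(** The tight inequality: for [t = d = 0] and [sigma = beta] it says [1 / alpha + 1 / beta > 1]. The
    factor 10 in [t_lt] pays for the errors. *)
Lemma mid_bound : t / 2 * (c + kb) + alpha * kb < c + kb.
Proof.
have /andP[a_gt0 a_lt1] := a_itv; have /andP[b_gt0 b_lt1] := b_itv.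
have s_gt0 := sigma_gt0.
have bs : b * sigma <= 1 + 2 * e.
  have /andP[_ s_le] := sigma_itv.
  have := ler_wpM2l (ltW b_gt0) s_le; rewrite !mulrDr (mulrA b beta) bE mul1r.
  have : b * e <= e by rewrite ler_piMl // ltW.
  have : d <= e by rewrite dE ler_piMr // ltW.
  lra.
have sq : (1 + 2 * e) * (1 + 2 * e) <= 1 + 5 * t.
  have : e * e <= 10 / 9 * t * (1 / 9) by rewrite ler_pM.
  move: e_le t_ge0; lra.
(* This is [(alpha - 1 + t / 2) / alpha]. Of the two factors [1 + 2 * e] in [sq], one comes from
   [kb] and the other bounds [sigma / beta]. *)
pose q := 1 - a + t * a / 2.
have q_gt0 : 0 < q.
  by rewrite ltr_wpDr ?subr_gt0 // !mulr_ge0 // ?invr_ge0 // ltW.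
have q_lt : q * (1 + 5 * t) < (1 - t / 2) * b.
  have ta : t * a <= t by rewrite ler_piMr // ltW.
  have : t * a * t <= t * (1 / 10) by rewrite ler_pM ?mulr_ge0 ?(ltW a_gt0) // ltW.
  have : t * b <= t by rewrite ler_piMr // ltW.
  have : 0 <= t * a by rewrite mulr_ge0 // ltW.
  move: t_ab t_ge0; rewrite /q; lra.
have qs : q * (1 + 2 * e) * (b * sigma) < (1 - t / 2) * b.
  apply: le_lt_trans q_lt; rewrite -mulrA ler_wpM2l ?(ltW q_gt0) //.
  by rewrite (le_trans _ sq) // ler_wpM2l //; move: e_ge0; lra.
have key : (alpha - 1 + t / 2) * (1 + 2 * e) * sigma < (1 - t / 2) * alpha.
  have ab_gt0 : 0 < alpha * beta by rewrite mulr_gt0.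
  move: qs; rewrite -(ltr_pM2l ab_gt0).
  have -> : alpha * beta * (q * (1 + 2 * e) * (b * sigma)) =
      (alpha - a * alpha + t * (a * alpha) / 2) * (1 + 2 * e) * (b * beta) * sigma.
    by rewrite /q; ring.
  have -> : alpha * beta * ((1 - t / 2) * b) = (1 - t / 2) * alpha * (b * beta) by ring.
  by rewrite aE bE !mulr1.
have := mulr_gt0 p_gt0 (_ : 0 < sigma^-1); rewrite invr_gt0 => /(_ s_gt0) ps_gt0.
have kbE : kb = (alpha - 1)^-1 * (1 + 2 * e) * (sigma^-1 * sigma).
  by rewrite mulVf ?gt_eqF // mulr1 /kb wE; ring.
move: key; rewrite -(ltr_pM2l ps_gt0) kbE /c; lra.
Qed.

End Numeric.

(** * Compactness, interior and Hausdorff distance *)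

Lemma continuous_add (T : topologicalType) (R : realType) (f g : T -> R) :
  continuous f -> continuous g -> continuous (fun x => f x + g x).
Proof. by move=> fc gc x; exact: (continuousD (fc x) (gc x)). Qed.

Lemma continuous_sub (T : topologicalType) (R : realType) (f g : T -> R) :
  continuous f -> continuous g -> continuous (fun x => f x - g x).
Proof. by move=> fc gc x; exact: (continuousB (fc x) (gc x)). Qed.

Lemma continuous_mul (T : topologicalType) (R : realType) (f g : T -> R) :
  continuous f -> continuous g -> continuous (fun x => f x * g x).
Proof. by move=> fc gc x; exact: (continuousM (fc x) (gc x)). Qed.

Lemma continuous_norm (T : topologicalType) (R : realType) (f : T -> R) :
  continuous f -> continuous (fun x => `|f x|).
Proof.
by move=> fc x; apply: continuous_comp; [exact: fc | exact: norm_continuous].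
Qed.

Section Topology.
Variables (R : realType) (n : nat) (alpha r : R).
Hypotheses (alpha_gt1 : 1 < alpha) (r_gt0 : 0 < r) (n_gt0 : (0 < n)%N).
Implicit Types (x y k : 'cV[R]_n.+1) (nu c : R).

Lemma normr_apex (s : R) : `|apex n s| <= `|s|.
Proof.
rewrite [leLHS]/Num.norm /= mx_normrE; apply: bigmax_le => //= -[i j] _ /=.
by rewrite mxE; case: (i == ord0); rewrite ?normr0.
Qed.

Lemma height_add_apex x s : height alpha (x + apex n s) = height alpha x + s.
Proof.
rewrite {1}/height; under eq_bigr do rewrite mxE mulrDr.
rewrite big_split /=; have := height_apex n alpha s; rewrite /height => /addIr ->.
by rewrite addrAC.
Qed.

(** Points are matched by keeping the parameter [l] and translating the base point, so the
    difference lies on the first axis. *)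
Lemma cone_near nu c nu' c' x : nu < height alpha (apex n c) ->
  nu' < height alpha (apex n c') -> cone alpha r nu c x ->
  exists2 y, cone alpha r nu' c' y & `|x - y| <= `|c - c'| + `|nu - nu'|.
Proof.
move=> nuG nuG' /(cone_split alpha_gt1 r_gt0 n_gt0 nuG)[l [k [l01 [hk kb] ->]]].
exists ((1 - l) *: apex n c' + l *: (k + apex n (nu' - nu))).
  apply: cone_join => //; [exact: ltW | split].
    by rewrite height_add_apex hk addrC subrK.
  by move=> i i0; rewrite !mxE (negPf i0) addr0; exact: kb.
have /andP[l0 l1] := l01.
have -> : (1 - l) *: apex n c + l *: k -
    ((1 - l) *: apex n c' + l *: (k + apex n (nu' - nu))) =
    apex n ((1 - l) * (c - c') + l * (nu - nu')).
  by apply/colP => i; rewrite !mxE; case: (i == ord0); rewrite ?mulr1n ?mulr0n; ring.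
rewrite (le_trans (normr_apex _)) // (le_trans (ler_normD _ _)) // !normrM.
rewrite (ger0_norm l0) ger0_norm ?subr_ge0 // lerD // ler_piMl //; lra.
Qed.

Lemma hausdorff_cone eps nu c nu' c' : nu < height alpha (apex n c) ->
  nu' < height alpha (apex n c') -> `|c - c'| + `|nu - nu'| <= eps ->
  hausdorff_close eps (cone alpha r nu c : set 'cV[R]_n.+1) (cone alpha r nu' c').
Proof.
move=> nuG nuG' le_eps; split => [x|y].
  by move=> /(cone_near nuG nuG')[y yC xy]; exists y => //; exact: le_trans le_eps.
move=> /(cone_near nuG' nuG)[x xC xy]; exists x => //.
by rewrite distrC (le_trans xy) // [`|c' - c|]distrC [`|nu' - nu|]distrC.
Qed.

Lemma height_continuous : continuous (height alpha : 'cV[R]_n.+1 -> R).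
Proof.
apply: continuous_add; last exact: cst_continuous.
apply: continuous_big => [|i _]; first exact: add_continuous.
by apply: continuous_mul; [exact: cst_continuous | exact: coord_continuous].
Qed.

Lemma bound_continuous nu c (i : 'I_n.+1) : continuous (fun x : 'cV[R]_n.+1 =>
  bnd n alpha r i * (height alpha (apex n c) - height alpha x) -
  `|x i 0| * (height alpha (apex n c) - nu)).
Proof.
apply: continuous_sub; apply: continuous_mul; try exact: cst_continuous.
- by apply: continuous_sub; [exact: cst_continuous | exact: height_continuous].
- by apply: continuous_norm; exact: coord_continuous.
Qed.

Lemma closed_cone nu c : closed (cone alpha r nu c : set 'cV[R]_n.+1).
Proof.
have -> : cone alpha r nu c = (height alpha @^-1` [set s | nu <= s]) `&`
    \bigcap_(i in [set i : 'I_n.+1 | i != ord0])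
      ((fun x : 'cV[R]_n.+1 =>
        bnd n alpha r i * (height alpha (apex n c) - height alpha x) -
        `|x i 0| * (height alpha (apex n c) - nu)) @^-1` [set s | 0 <= s]).
  apply/seteqP; split => x /= [hx xb]; split => // i /xb /=; rewrite subr_ge0 //.
apply: closedI.
  by apply: preimage_closed; [move=> x _; exact: height_continuous | exact: closed_ge].
apply: closed_bigI => i _.
by apply: preimage_closed; [move=> x _; exact: bound_continuous | exact: closed_ge].
Qed.

(** Finitely many strict inequalities between continuous functions persist nearby; [nu < nu'] makes
    the height inequality strict as well. *)
Lemma target_interior nu nu' c : nu < nu' ->
  target alpha r nu nu' c `<=` interior (cone alpha r nu c : set 'cV[R]_n.+1).
Proof.
move=> nu_lt x [hx xb].
have near_h : \forall y \near x, nu < height alpha y.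
  by apply: (@cvgr_gt _ _ _ _ _ _ (@height_continuous x)); exact: lt_le_trans hx.
have near_b : \forall y \near x, forall i : 'I_n.+1, i != ord0 ->
    0 < bnd n alpha r i * (height alpha (apex n c) - height alpha y) -
      `|y i 0| * (height alpha (apex n c) - nu).
  apply: (@filter_forall _ _ _ _ (nbhs_filter x)) => i; have [->|i0] := eqVneq i ord0.
    by apply: nearW.
  have : 0 < bnd n alpha r i * (height alpha (apex n c) - height alpha x) -
      `|x i 0| * (height alpha (apex n c) - nu) by rewrite subr_gt0 xb.
  move=> /(@cvgr_gt _ _ _ _ _ _ (@bound_continuous nu c i x)).
  by apply: filterS => y ? _.
rewrite /interior; apply: filterS2 near_h near_b => y hy yb.
by split; [exact: ltW | move=> i /yb; rewrite subr_gt0 => /ltW].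
Qed.

(** Transposition carries the box to a product of segments in the space of row vectors. *)
Lemma compact_box (m : 'I_n.+1 -> R) :
  compact [set x : 'cV[R]_n.+1 | forall i, `|x i 0| <= m i].
Proof.
have -> : [set x : 'cV[R]_n.+1 | forall i, `|x i 0| <= m i] =
    trmx @` [set v : 'rV[R]_n.+1 | forall i, `[- m i, m i]%classic (v ord0 i)].
  apply/seteqP; split => [x xm|_ [v vm <-] i].
    exists x^T; last exact: trmxK.
    by move=> i; rewrite /= in_itv /= mxE -ler_norml.
  by have := vm i; rewrite /= in_itv /= mxE -ler_norml.
apply: continuous_compact; last first.
  by apply: (@rV_compact _ _ (fun i => `[- m i, m i]%classic)) => i; exact: segment_compact.
apply: continuous_subspaceT => v A /nbhs_ballP[e e0 eA].
apply/nbhs_ballP; exists e => // w [_ vw]; apply: eA; split => // i j.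
by rewrite !mxE; exact: vw.
Qed.

Lemma compact_cone nu c : nu < height alpha (apex n c) ->
  compact (cone alpha r nu c : set 'cV[R]_n.+1).
Proof.
move=> nuG; set m := fun i : 'I_n.+1 => if i == ord0
  then `|c| + `|nu - (alpha - 1)^-1| + width n alpha r else bnd n alpha r i.
apply: (subclosed_compact (@closed_cone nu c) (@compact_box m)).
move=> x /(cone_split alpha_gt1 r_gt0 n_gt0 nuG)[l [k [/andP[l0 l1] kbase ->]]] i.
have nl0 : 0 <= 1 - l by rewrite subr_ge0.
have nl1 : 1 - l <= 1 by rewrite gerBl.
rewrite !mxE (le_trans (ler_normD _ _)) // !normrM (ger0_norm l0) ger0_norm //.
rewrite /m; have [->|i0] := eqVneq i ord0.
  rewrite mulr1n -addrA lerD ?ler_piMl // (@le_trans _ _ `|k ord0 0|) ?ler_piMl //.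
  have := base_coord0 alpha_gt1 kbase.
  have := ler_normD (k ord0 0 - (nu - (alpha - 1)^-1)) (nu - (alpha - 1)^-1).
  rewrite subrK; lra.
by rewrite normr0 mulr0 add0r (le_trans _ (kbase.2 i i0)) // ler_piMl.
Qed.

End Topology.

(** * Identification of Omega *)

(** Otherwise 1 would be an eigenvalue other than [mu], of modulus at most [r < 1]. *)
Lemma dominant_eigenvalue_unitmx (R : realType) n (A : 'M[R]_n.+1) (mu r : R) :
  dominant_eigenvalue A mu r -> mu != 1 -> r < 1 -> 1%:M - A \in unitmx.
Proof.
move=> [_ _ evr] mu_neq1 r_lt1; apply: contraT => nunit.
have ev1 : eigenvalue A 1.
  by rewrite /eigenvalue /eigenspace kermx_eq0 row_free_unit -opprB -scaleN1r unitmxZ ?unitrN1.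
have : eigenvalue (map_mx (real_complex R) A) 1.
  move: ev1; rewrite !eigenvalue_root_char -map_char_poly.
  by rewrite -(rmorph1 (real_complex R)) fmorph_root.
move=> /evr; rewrite -(rmorph1 (real_complex R)) (inj_eq (@complexI _)) eq_sym => /(_ mu_neq1).
by rewrite normc_def /= expr0n addr0 sqrtr_sqr normr1 lecR leNgt r_lt1.
Qed.

Section Identification.
Variables (R : realType) (n : nat) (alpha r : R).
Hypotheses (alpha_gt1 : 1 < alpha).
Implicit Types (x : 'cV[R]_n.+1) (aL aR : 'I_n.+1 -> R).

(** The left branch fixes the point and multiplies its height by [alpha], which is not 1. *)
Lemma height_fixed_pt_L aL : 1%:M - bcnf_mx aL \in unitmx -> slope alpha aL = - alpha ->
  height alpha (fixed_pt_L aL : 'cV[R]_n.+1) = 0.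
Proof.
move=> unitA aL_slope; set Y := fixed_pt_L aL.
have YE : Y = bcnf_branch aL Y.
  apply/eqP; rewrite /bcnf_branch -subr_eq0 opprD addrA subr_eq0 -{1}[Y]mul1mx -mulmxBl.
  by rewrite mulmxA mulmxV // mul1mx.
have : height alpha Y = alpha * height alpha Y.
  by rewrite {1}YE height_branch // aL_slope addNr mul0r subr0.
move/eqP; rewrite -subr_eq0 -{1}[height alpha Y]mul1r -mulrBl mulf_eq0 subr_eq0.
by rewrite lt_eqF //= => /eqP.
Qed.

Lemma E_set_height aL x : 1%:M - bcnf_mx aL \in unitmx -> slope alpha aL = - alpha ->
  E_set aL alpha x <-> height alpha x = 0.
Proof.
move=> unitA aL_slope; rewrite /E_set /=.
have an_neq0 : alpha ^+ n != 0 by rewrite expf_neq0 // gt_eqF // (lt_trans ltr01).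
have uE : u_row n alpha *m (x - fixed_pt_L aL) = (alpha ^+ n * height alpha x)%:M.
  rewrite [LHS]mx11_scalar; congr (_%:M).
  by rewrite mulmxBr mxE [X in _ + X]mxE !u_row_height // height_fixed_pt_L //; ring.
rewrite uE; split=> [/matrixP/(_ 0 0)|->]; last by rewrite mulr0 raddf0.
by rewrite !mxE mulr1n => /eqP; rewrite mulf_eq0 (negPf an_neq0) => /eqP.
Qed.

Lemma C_ptE aL aR : 1%:M - bcnf_mx aL \in unitmx -> slope alpha aL = - alpha ->
  slope alpha aR != 0 ->
  C_pt aL aR alpha = apex n (alpha / (alpha - 1) / slope alpha aR).
Proof.
move=> unitA aL_slope aR_slope.
have alpha1_neq0 : alpha - 1 != 0 by rewrite subr_eq0 gt_eqF.
have branchE s : height alpha (bcnf_branch aR (apex n s)) =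
    alpha / (alpha - 1) - slope alpha aR * s.
  by rewrite height_branch // height_apex mxE eqxx mulr1n; field.
(* Existence comes first, as [xget] would otherwise return its default 0; both parts rest on the
   image height being affine and non-constant along the first axis. *)
apply: xget_unique => [|x [x0]].
  split=> [i /negPf i0|]; first by rewrite mxE i0.
  by apply/E_set_height => //; rewrite branchE; field; rewrite aR_slope.
have -> : x = apex n (x ord0 0).
  apply/colP => i; rewrite [RHS]mxE; have [->|i0] := eqVneq i ord0; first by [].
  by rewrite x0.
move=> /(E_set_height _ unitA aL_slope); rewrite branchE => /eqP; rewrite subr_eq0 => /eqP ->.
by rewrite mulrAC divff // mul1r.
Qed.

Lemma K_setE aL : 1%:M - bcnf_mx aL \in unitmx -> slope alpha aL = - alpha ->
  K_set aL alpha r = base alpha r 0.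
Proof.
move=> unitA aL_slope; apply/seteqP; split=> x [xE xH]; split=> //.
  exact/(E_set_height _ unitA aL_slope).
exact/(E_set_height _ unitA aL_slope).
Qed.

End Identification.

(** * Small perturbations of the base height, and conclusion *)

Lemma near0_lt (R : realType) (f g : R -> R) : continuous f -> continuous g ->
  f 0 < g 0 -> \forall s \near (0 : R), f s < g s.
Proof.
move=> fc gc; rewrite -subr_gt0 => /(@cvgr_gt _ _ _ _ _ _ (continuous_sub gc fc (x := 0))).
by apply: filterS => s; rewrite subr_gt0.
Qed.

Ltac continuity_tac :=
  repeat first [ assumption | exact: cst_continuous | apply: continuous_sub
    | apply: continuous_add | apply: continuous_mul | apply: continuous_norm ].

Theorem proposition3p1 (R : realType) (n : nat) (hn : (2 <= n.+1)%N)
    (aL aR : 'I_n.+1 -> R) (alpha beta r : R)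
    (halpha : 1 < alpha) (hbeta : - beta < -1) (hr0 : 0 < r) (hr1 : r < 1)
    (hL : dominant_eigenvalue (bcnf_mx aL) alpha r)
    (hR : dominant_eigenvalue (bcnf_mx aR) (- beta) r)
    (h1 : r * (n.+1 - 1)%N%:R < 3 / 7 * (1 - 1 / alpha))
    (h2 : r * (n.+1 - 1)%N%:R < 1 / 10 * (1 / alpha + 1 / beta - 1)) :
  bcnf aL aR @` Omega aL aR alpha r `<=` Omega aL aR alpha r /\
  perturbable_to_trapping_region (bcnf aL aR) (Omega aL aR alpha r).
Proof.
have n_gt0 : (0 < n)%N by rewrite -ltnS.
have beta_gt1 : 1 < beta by rewrite -ltrN2.
have alpha_gt0 : 0 < alpha := lt_trans ltr01 halpha.
rewrite subn1 /= in h2; pose t := r * n%:R; rewrite -/t in h2.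
have t_ge0 : 0 <= t by rewrite mulr_ge0 // ltW.
have t_alpha : t / alpha <= 1 / 10.
  have b_lt1 : 1 / beta < 1 by rewrite div1r invf_lt1 // (lt_trans ltr01).
  have a_lt1 : 1 / alpha < 1 by rewrite div1r invf_lt1.
  rewrite ler_pdivrMr //; move: h2 b_lt1 a_lt1 halpha; lra.
have d_ge0 : 0 <= delta n alpha r.
  by rewrite subr_ge0 exprn_ege1 // lerDl divr_ge0 // ltW.
have d_le : delta n alpha r <= 10 / 9 * (t / alpha).
  have tE : t / alpha = n%:R * (r / alpha) by rewrite /t mulrA [n%:R * r]mulrC.
  by rewrite tE in t_alpha *; apply: expr1D_sub1_le => //; rewrite divr_ge0 // ltW.
have [bL [bL0 bL_le aLE]] := dominant_eigenvalue_coef hL.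
have [bR [bR0 bR_le aRE]] := dominant_eigenvalue_coef hR.
have aL_le := coef_le hr0 bL_le aLE; rewrite (gtr0_norm alpha_gt0) in aL_le.
have aR_le := coef_le hr0 bR_le aRE.
rewrite normrN (gtr0_norm (lt_trans ltr01 beta_gt1)) in aR_le.
have aL_slope : slope alpha aL = - alpha.
  by have [B -> _] := slopeE halpha bL0 bL_le aLE; ring.
have aR_slope : `|slope alpha aR - beta| <= (alpha + beta) * delta n alpha r.
  have [B -> B_near] := slopeE halpha bR0 bR_le aRE.
  have -> : alpha * (B - 1) - - beta * B - beta = (alpha + beta) * (B - 1) by ring.
  have ab_gt0 : 0 < alpha + beta by rewrite addr_gt0 // (lt_trans ltr01).
  by rewrite normrM (gtr0_norm ab_gt0) ler_wpM2l // ltW.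
set sigma := slope alpha aR in aR_slope.
have s_gt0 : 0 < sigma := sigma_gt0 halpha beta_gt1 h2 d_ge0 d_le aR_slope.
have s_neq0 : sigma != 0 by rewrite gt_eqF.
have w_lt : width n alpha r < (alpha - 1)^-1 :=
  width_lt halpha beta_gt1 h2 d_le.
have base0 := base_bound halpha beta_gt1 t_ge0 h2 d_ge0 d_le.
have apex0 := apex_bound halpha beta_gt1 h2 d_ge0 d_le aR_slope.
have mid0 := mid_bound halpha beta_gt1 t_ge0 h2 d_ge0 d_le aR_slope.
rewrite -/(width n alpha r) in base0 mid0.
pose p := (alpha - 1)^-1; have p_gt0 : 0 < p by rewrite invr_gt0 subr_gt0.
pose kb := p + width n alpha r.
pose c nu := (alpha / (alpha - 1) - 2 * nu) / sigma.
pose G nu := c nu + p.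
have c0E : c 0 = alpha / (alpha - 1) / sigma by rewrite /c mulr0 subr0.
have c0_gt0 : 0 < c 0 by rewrite c0E !mulr_gt0 // invr_gt0.
have G0_gt0 : 0 < G 0 by rewrite addr_gt0.
have c_cont : continuous c.
  apply: continuous_mul; last exact: cst_continuous.
  apply: continuous_sub; first exact: cst_continuous.
  by apply: continuous_mul; [exact: cst_continuous | move=> x; exact: cvg_id].
have G_cont : continuous G by apply: continuous_add => //; exact: cst_continuous.
(* All conditions on [nu] are strict and continuous in it, so they pass from [nu = 0] to nearby
   values. *)
pose good nu := [/\ 0 < c nu, nu + width n alpha r < p,
  (alpha + t / 2) * kb * (G nu - nu) + alpha * t / (alpha - 1) * (G nu - nu) <
     2 * alpha / (alpha - 1) * (G nu - alpha * nu),
  (beta + t / 2) * c nu * (G nu - nu) < 2 * alpha / (alpha - 1) * (G nu - 2 * nu) &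
  t / 2 * (G nu - nu) * (c nu + kb) + alpha * (G nu - nu) * kb <
     (G nu - alpha * nu) * (c nu + kb)].
have good_target nu x : 0 <= nu -> good nu -> cone alpha r nu (c nu) x ->
    target alpha r nu (Num.min 2 alpha * nu) (c nu) (bcnf aL aR x).
  move=> nu_ge0 [g1 g2 g3 g4 g5].
  exact: (bcnf_cone_target halpha hr0 aL_le aR_le aL_slope).
(* At [nu = 0] the last three conditions are the scalar inequalities multiplied by [G 0 > 0]. *)
have good0 : good 0.
  rewrite /good !mulr0 !subr0 add0r; split=> //.
  - by rewrite -mulrDl ltr_pM2r.
  - by rewrite ltr_pM2r // c0E.
  - rewrite -c0E -/kb in mid0; move: mid0; rewrite -(ltr_pM2r G0_gt0); lra.
have unitA : 1%:M - bcnf_mx aL \in unitmx.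
  by apply: dominant_eigenvalue_unitmx hL _ hr1; rewrite gt_eqF.
have nuG nu : good nu -> nu < height alpha (apex n (c nu)).
  move=> [c_gt0 nu_lt _ _ _]; rewrite height_apex -/p.
  have := width_ge0 n halpha hr0; lra.
have -> : Omega aL aR alpha r = cone alpha r 0 (c 0).
  apply: Omega_cone => //; [exact: nuG | | exact: K_setE].
  by rewrite C_ptE // c0E.
split.
  move=> _ [x xO <-]; have [hx xb] := good_target 0 x (lexx 0) good0 xO.
  by rewrite mulr0 in hx; split=> // i i0; exact: ltW (xb i i0).
move=> eps eps_gt0.
have near_good: \forall nu \near (0 : R), good nu /\ `|c nu - c 0| + `|nu| < eps.
  have cont_id : continuous (fun s : R => s) by move=> s; exact: cvg_id.
  have n1 : \forall nu \near (0 : R), 0 < c nu by apply: near0_lt => //; exact: cst_continuous.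
  have n2 : \forall nu \near (0 : R), nu + width n alpha r < p.
    apply: near0_lt; [continuity_tac | continuity_tac | by rewrite add0r].
  have n3 : \forall nu \near (0 : R),
      (alpha + t / 2) * kb * (G nu - nu) + alpha * t / (alpha - 1) * (G nu - nu) <
      2 * alpha / (alpha - 1) * (G nu - alpha * nu).
    by apply: near0_lt; [continuity_tac | continuity_tac | case: good0].
  have n4 : \forall nu \near (0 : R),
      (beta + t / 2) * c nu * (G nu - nu) < 2 * alpha / (alpha - 1) * (G nu - 2 * nu).
    by apply: near0_lt; [continuity_tac | continuity_tac | case: good0].
  have n5 : \forall nu \near (0 : R),
      t / 2 * (G nu - nu) * (c nu + kb) + alpha * (G nu - nu) * kb <
      (G nu - alpha * nu) * (c nu + kb).
    by apply: near0_lt; [continuity_tac | continuity_tac | case: good0].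
  have n6 : \forall nu \near (0 : R), `|c nu - c 0| + `|nu| < eps.
    apply: near0_lt; [continuity_tac | continuity_tac | by rewrite subrr normr0 addr0].
  by near=> nu; split; [split|]; near: nu.
have /nbhs_ballP[e /= e_gt0 eP] := near_good.
(* A positive parameter inside the ball of radius [e] around 0 on which [good] and the distance
   bound hold. *)
pose nu := e / 2; have nu_gt0 : 0 < nu by rewrite divr_gt0.
have [gnu near_nu] : good nu /\ `|c nu - c 0| + `|nu| < eps.
  apply: eP; rewrite /ball /= sub0r normrN gtr0_norm // ltr_pdivrMr //; lra.
exists (cone alpha r nu (c nu)); split; last first.
  by apply: hausdorff_cone => //; [exact: nuG | exact: nuG | rewrite subr0 ltW].
split.
- exists (apex n (c nu)); apply: cone_apex; exact/ltW/nuG.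
- by apply: compact_cone => //; exact: nuG.
move=> _ [x xS <-]; apply: target_interior (good_target nu x (ltW nu_gt0) gnu xS).
(* Both 2 and [alpha] exceed 1, so image heights stay strictly above [nu]. *)
by rewrite ltr_pMl // lt_min ltr1n.
Unshelve. all: by end_near. Qed.
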